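(* Let $0<l_2\le l_1$ be real numbers. For any $x$ with $0<x<\infty$ there exists a unique triangle $ABC$ with $l_a=l_2$, $l_b=l_1$ and $h_c=x$.
   Context: For a non-degenerate triangle $ABC$ in the Euclidean plane, $l_a$ and $l_b$ denote the lengths of the internal angle bisectors drawn from $A$ and $B$ respectively, measured from the vertex to the opposite side; $h_c$ is the length of the height (altitude) from $C$ onto the line $AB$. Uniqueness of triangles is understood up to congruence respecting the vertex labels. *)

(* Defs.v *)
From mathcomp Require Import all_boot all_order all_algebra.
From mathcomp Require Import reals trigo.

Set Implicit Arguments.
Unset Strict Implicit.
Unset Printing Implicit Defensive.

Import Order.TTheory GRing.Theory Num.Theory.

Local Open Scope ring_scope.

(* The Euclidean plane is 'rV[R]_2 with the dot product.  The library norm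
   `|u| on row vectors is the sup norm, hence the separate [enorm]. *)

Definition dot (R : realType) (u v : 'rV[R]_2) : R := (u *m v^T) 0 0.

Definition enorm (R : realType) (u : 'rV[R]_2) : R := Num.sqrt (dot u u).

Definition edist (R : realType) (P Q : 'rV[R]_2) : R := enorm (Q - P).

(* Unsigned angle PQS at the vertex Q, in [0, pi]; only meaningful when
   P != Q and S != Q. *)
Definition angle (R : realType) (P Q S : 'rV[R]_2) : R :=
  acos (dot (P - Q) (S - Q) / (enorm (P - Q) * enorm (S - Q))).

Definition on_line (R : realType) (P Q X : 'rV[R]_2) : Prop :=
  exists t : R, X = (1 - t) *: P + t *: Q.

Definition on_segment (R : realType) (P Q X : 'rV[R]_2) : Prop :=
  exists2 t : R, 0 <= t <= 1 & X = (1 - t) *: P + t *: Q.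

(* Affine independence of the three vertices. *)
Definition nondegenerate_triangle (R : realType) (A B C : 'rV[R]_2) : Prop :=
  row_free (col_mx (B - A) (C - A)).

(* In a non-degenerate triangle exactly one D satisfies [bisector_foot] and
   exactly one H satisfies [altitude_foot], so the relations [bisector_length]
   and [height_length] each determine the length. *)
Definition bisector_foot (R : realType) (A B C D : 'rV[R]_2) : Prop :=
  on_segment B C D /\ angle B A D = angle D A C.

(* [l] is the length of the internal bisector from the first vertex [A]. *)
Definition bisector_length (R : realType) (A B C : 'rV[R]_2) (l : R) : Prop :=
  exists2 D, bisector_foot A B C D & edist A D = l.

Definition altitude_foot (R : realType) (C A B H : 'rV[R]_2) : Prop :=
  on_line A B H /\ dot (C - H) (B - A) = 0.

(* [h] is the length of the altitude from the first vertex [C]. *)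
Definition height_length (R : realType) (C A B : 'rV[R]_2) (h : R) : Prop :=
  exists2 H, altitude_foot C A B H & edist C H = h.

Definition plane_isometry (R : realType) (f : 'rV[R]_2 -> 'rV[R]_2) : Prop :=
  forall P Q, edist (f P) (f Q) = edist P Q.

(* Congruence respecting the labels; reflections are allowed. *)
Definition congruent (R : realType) (A B C A' B' C' : 'rV[R]_2) : Prop :=
  exists2 f : 'rV[R]_2 -> 'rV[R]_2,
    plane_isometry f & [/\ f A = A', f B = B' & f C = C'].

(* Main.v *)
(** Let [k = cos (A / 2)] and [s = sin (A / 2)], let [k'], [s'] be the same for [B],
    and let [c = AB].  The bisector from [A] satisfies [x / l2 = x / (2 c k) + s],
    and similarly for [B], while the foot of the altitude gives
    [c = x (cot A + cot B)].
    Uniqueness: for a fixed bisector length, a larger [c] forces a larger angle,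
    hence a smaller cotangent; so two solutions with [c <= c'] also satisfy
    [c' <= c], and [c] determines both angles.
    Existence: [s] determines [c] through the bisector from [A], and then the angle [B]
    through the altitude.  The bisector from [B] becomes a continuous equation in
    [s] on [0 <= s <= min 1 (x / l2)], solved by the intermediate value theorem. *)

From mathcomp Require Import all_boot all_order all_algebra.
From mathcomp Require Import classical_sets reals topology normedtype.
From mathcomp Require Import realfun trigo ring lra.
Require Import Defs.
Set Implicit Arguments.
Unset Strict Implicit.
Unset Printing Implicit Defensive.
Import Order.TTheory GRing.Theory Num.Theory numFieldNormedType.Exports.
Local Open Scope ring_scope.

(** Here [k] is a certificate exhibiting [y - z] as a multiple of [a - b]: once it is supplied,
    [ring] proves an identity that holds only modulo [a = b]. *)
Lemma eq_lincomb (T : comPzRingType) (k a b y z : T) :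
  a = b -> y - z = k * (a - b) -> y = z.
Proof. by move=> -> /eqP; rewrite subrr mulr0 subr_eq0 => /eqP. Qed.

(** * Bisectors and altitudes in vector form *)

Section PlaneVectors.
Variable R : realType.
Implicit Types (u v w : 'rV[R]_2) (A B C D : 'rV[R]_2).

Definition cross u v : R := u 0 0 * v 0 1 - u 0 1 * v 0 0.

Lemma dotE u v : dot u v = u 0 0 * v 0 0 + u 0 1 * v 0 1.
Proof.
rewrite /dot mxE !big_ord_recl big_ord0 addr0 !mxE.
by congr (_ * _ + u 0 _ * v 0 _); apply/val_inj.
Qed.

Lemma rV2P u v : u 0 0 = v 0 0 -> u 0 1 = v 0 1 -> u = v.
Proof.
move=> e0 e1; apply/rowP => i; case: (unliftP 0 i) => [j|] ->; last exact: e0.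
by rewrite ord1 (_ : lift 0 0 = 1) //; apply/val_inj.
Qed.

Lemma det_mx2 (M : 'M[R]_2) : \det M = M 0 0 * M 1 1 - M 0 1 * M 1 0.
Proof.
rewrite (expand_det_row _ 0) !big_ord_recl big_ord0 /cofactor !det_mx11 !mxE.
rewrite addr0 expr0 mul1r expr1 mulN1r mulrN.
congr (_ * M _ _ - M _ _ * M _ _); exact/val_inj.
Qed.

Lemma det_col_mx u v : \det (col_mx u v : 'M_2) = cross u v.
Proof.
rewrite det_mx2 /cross.
have E0 : 0 = lshift 1 (0 : 'I_1) :> 'I_2 by apply/val_inj.
have E1 : 1 = rshift 1 (0 : 'I_1) :> 'I_2 by apply/val_inj.
have e0 j : (col_mx u v : 'M_2) 0 j = u 0 j by rewrite E0; exact: col_mxEu.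
have e1 j : (col_mx u v : 'M_2) 1 j = v 0 j by rewrite E1; exact: col_mxEd.
by rewrite !e0 !e1.
Qed.

Lemma nondegenerateE A B C :
  nondegenerate_triangle A B C <-> cross (B - A) (C - A) != 0.
Proof. by rewrite -det_col_mx -unitfE -unitmxE -row_free_unit. Qed.

Lemma nondegenerate_swap A B C :
  nondegenerate_triangle A B C -> nondegenerate_triangle B A C.
Proof.
rewrite !nondegenerateE /cross !mxE => h; apply: contra h => /eqP h.
by apply/eqP; lra.
Qed.

Lemma dot_ge0 u : 0 <= dot u u.
Proof. by rewrite dotE -!expr2 addr_ge0 ?sqr_ge0. Qed.

Lemma enorm_ge0 u : 0 <= enorm u. Proof. exact: sqrtr_ge0. Qed.

Lemma enorm_sqr u : enorm u ^+ 2 = dot u u.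
Proof. exact/sqr_sqrtr/dot_ge0. Qed.

Lemma enorm_gt0 u : (0 < enorm u) = (u != 0).
Proof.
rewrite lt0r enorm_ge0 andbT -sqrf_eq0 enorm_sqr dotE -!expr2.
congr (~~ _); rewrite paddr_eq0 ?sqr_ge0// !sqrf_eq0.
apply/andP/eqP => [[/eqP h0 /eqP h1]|->]; last by rewrite !mxE.
by apply: rV2P; rewrite mxE.
Qed.

Lemma edistC A B : edist A B = edist B A.
Proof. by rewrite /edist /enorm !dotE !mxE; congr Num.sqrt; ring. Qed.

(** Lagrange's identity; the [cross] term is what makes Cauchy-Schwarz strict for independent
    vectors. *)
Lemma dot_cross u v :
  (enorm u * enorm v) ^+ 2 = dot u v ^+ 2 + cross u v ^+ 2.
Proof. by rewrite exprMn !enorm_sqr !dotE /cross; ring. Qed.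

Lemma cross_neq0 u v : cross u v != 0 -> u != 0 /\ v != 0.
Proof.
by move=> h; split; apply: contra h => /eqP ->; apply/eqP;
  rewrite /cross !mxE; ring.
Qed.

Lemma dot_le u v : - (enorm u * enorm v) <= dot u v <= enorm u * enorm v.
Proof.
rewrite -ler_norml -[leRHS]ger0_norm ?mulr_ge0 ?enorm_ge0//.
by rewrite -ler_sqr ?nnegrE// !real_normK ?num_real// dot_cross lerDl sqr_ge0.
Qed.

Lemma dot_lt u v : cross u v != 0 ->
  - (enorm u * enorm v) < dot u v < enorm u * enorm v.
Proof.
move=> h; rewrite -ltr_norml -[ltRHS]ger0_norm ?mulr_ge0 ?enorm_ge0//.
rewrite -ltr_sqr ?nnegrE// !real_normK ?num_real// dot_cross ltrDl.
by rewrite lt0r sqr_ge0 sqrf_eq0 h.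
Qed.

(** By Cauchy-Schwarz both quotients lie in [-1, 1], where [acos] is injective; the common factor
    [enorm v] cancels and no trigonometry remains. *)
Lemma angle_eqP u v w : u != 0 -> v != 0 -> w != 0 ->
  acos (dot u v / (enorm u * enorm v)) = acos (dot v w / (enorm v * enorm w)) <->
  dot u v * enorm w = dot v w * enorm u.
Proof.
rewrite -!enorm_gt0 => u0 v0 w0.
have itv (a b : 'rV[R]_2) : 0 < enorm a -> 0 < enorm b ->
    dot a b / (enorm a * enorm b) \in `[-1, 1].
  move=> a0 b0; have := dot_le a b.
  by rewrite in_itv/= ler_pdivlMr ?ler_pdivrMr ?mulr_gt0// mulN1r mul1r.
have p0 := mulf_neq0 (lt0r_neq0 u0) (lt0r_neq0 v0).
have q0 := mulf_neq0 (lt0r_neq0 v0) (lt0r_neq0 w0).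
split=> [/(congr1 cos)|h].
  rewrite !acosK ?itv// => /eqP; rewrite eqr_div// => /eqP h.
  by apply: (mulfI (lt0r_neq0 v0)); ring: h.
by congr acos; apply/eqP; rewrite eqr_div//; apply/eqP; ring: h.
Qed.

Lemma dot_lincomb a b u v : dot (a *: u + b *: v) (a *: u + b *: v) =
  a ^+ 2 * dot u u + b ^+ 2 * dot v v + 2 * a * b * dot u v.
Proof. by rewrite !dotE !mxE; ring. Qed.

(** The angle bisector theorem: the foot is the point [(1 - t) *: B + t *: C] with
    [t = AB / (AB + AC)]. The equation is cleared of that denominator. *)
Lemma bisector_footP A B C D : nondegenerate_triangle A B C ->
  bisector_foot A B C D <->
  (edist A B + edist A C) *: (D - A) =
    edist A C *: (B - A) + edist A B *: (C - A).
Proof.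
move=> /nondegenerateE ABC; have [B0 C0] := cross_neq0 ABC.
rewrite /edist; set u := B - A in ABC B0 *; set v := C - A in ABC C0 *.
set c := enorm u; set b := enorm v.
have c0 : 0 < c by rewrite enorm_gt0.
have b0 : 0 < b by rewrite enorm_gt0.
have bc0 : 0 < c + b by rewrite addr_gt0.
have DE t : (1 - t) *: B + t *: C - A = (1 - t) *: u + t *: v.
  by apply: rV2P; rewrite /u /v !mxE; ring.
have angleE t : angle B A (A + ((1 - t) *: u + t *: v)) =
    angle (A + ((1 - t) *: u + t *: v)) A C <-> t * (c + b) = c.
  set d := _ *: _ + _.
  (* If [d] were zero, [cross u d = t * cross u v] and [cross d v = (1 - t) * cross u v] would both
     vanish, forcing [t = 0] and [t = 1]. *)
  have d0 : d != 0.
    apply/eqP => d0.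
    have ud : cross u d = t * cross u v by rewrite /cross /d !mxE; ring.
    have dv : cross d v = (1 - t) * cross u v by rewrite /cross /d !mxE; ring.
    have u0 : cross u 0 = 0 by rewrite /cross !mxE; ring.
    have v0 : cross 0 v = 0 by rewrite /cross !mxE; ring.
    move: ud dv; rewrite d0 u0 v0 => /esym/eqP + /esym/eqP.
    rewrite !mulf_eq0 (negPf ABC) !orbF => /eqP h1 /eqP h2.
    by move/eqP: h2; rewrite h1 subr0 oner_eq0.
  rewrite /angle [A + d - A]addrC addKr angle_eqP// -/u -/v -/b -/c.
  have -> : dot u d = (1 - t) * c ^+ 2 + t * dot u v.
    by rewrite enorm_sqr !dotE /d !mxE; ring.
  have -> : dot d v = (1 - t) * dot u v + t * b ^+ 2.
    by rewrite enorm_sqr !dotE /d !mxE; ring.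
  have /andP[_ g0] := dot_lt ABC; rewrite -/b -/c in g0.
  split=> [h|tE]; last first.
    have e : (1 - t) * c = t * b by lra.
    apply: (eq_lincomb (k := c * b - dot u v) e); ring.
  (* This product is the difference of the two sides of [h]; its second factor is positive by strict
     Cauchy-Schwarz. *)
  suff /eqP : (c - t * (c + b)) * (c * b - dot u v) = 0.
    by rewrite mulf_eq0 [_ * _ - _ == 0]subr_eq0 (gt_eqF g0) orbF subr_eq0 => /eqP.
  by lra.
split=> [[[t t01 DtE]]|h].
  have DA : D - A = (1 - t) *: u + t *: v by rewrite -DE DtE.
  have DAE : D = A + ((1 - t) *: u + t *: v) by rewrite -DA subrKC.
  rewrite {1 2}DAE => /angleE tE.
  by rewrite DA [LHS]scalerDr !scalerA; congr (_ *: _ + _ *: _); lra.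
pose t := c / (c + b).
have tE : t * (c + b) = c by rewrite divfK ?gt_eqF.
have DA : D - A = (1 - t) *: u + t *: v.
  apply: (scalerI (lt0r_neq0 bc0)); rewrite h [RHS]scalerDr !scalerA.
  by congr (_ *: _ + _ *: _); lra.
have DAE : D = A + ((1 - t) *: u + t *: v) by rewrite -DA subrKC.
split; last by rewrite DAE; apply/angleE.
exists t; first by apply/andP; split;
  [exact/divr_ge0/ltW/bc0/ltW|rewrite /t ler_pdivrMr// mul1r lerDl ltW].
by apply: (addIr (- A)); rewrite DE DA.
Qed.

(** The dot product hypothesis says cos A = 2 k^2 - 1, so [k] is cos (A / 2). With b = AC and c =
    AB, (b + c) AD is the norm of b (B - A) + c (C - A), whose square is 2 b^2 c^2 (1 + cos A) = (2
    b c k)^2. *)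
Lemma bisector_lengthP A B C l k : nondegenerate_triangle A B C -> 0 <= k ->
  dot (B - A) (C - A) = edist A B * edist A C * (2 * k ^+ 2 - 1) ->
  bisector_length A B C l <->
  l * (edist A B + edist A C) = 2 * edist A B * edist A C * k.
Proof.
move=> ABC k0 g; have /nondegenerateE/cross_neq0[B0 C0] := ABC.
have c0 : 0 < edist A B by rewrite enorm_gt0.
have b0 : 0 < edist A C by rewrite enorm_gt0.
have s0 := addr_gt0 c0 b0.
have lenE D : bisector_foot A B C D ->
    edist A D * (edist A B + edist A C) = 2 * edist A B * edist A C * k.
  move/(bisector_footP _ ABC) => h.
  have l0 : 0 <= edist A D * (edist A B + edist A C).
    by rewrite mulr_ge0 ?enorm_ge0 ?ltW.
  have r0 : 0 <= 2 * edist A B * edist A C * k.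
    by rewrite !mulr_ge0 ?enorm_ge0.
  apply/eqP; rewrite -(eqrXn2 (n := 2))//.
  have -> : (edist A D * (edist A B + edist A C)) ^+ 2 =
      dot (edist A C *: (B - A) + edist A B *: (C - A))
          (edist A C *: (B - A) + edist A B *: (C - A)).
    by rewrite -h exprMn enorm_sqr !dotE !mxE; ring.
  have -> : dot (edist A C *: (B - A) + edist A B *: (C - A))
          (edist A C *: (B - A) + edist A B *: (C - A)) =
      edist A C ^+ 2 * edist A B ^+ 2 + edist A B ^+ 2 * edist A C ^+ 2
      + 2 * edist A C * edist A B * dot (B - A) (C - A).
    by rewrite dot_lincomb -!enorm_sqr /edist; ring.
  by rewrite g; apply/eqP; ring.
split=> [[D /lenE + <-]//|h].
pose D := A + (edist A B + edist A C)^-1 *: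
  (edist A C *: (B - A) + edist A B *: (C - A)).
have DP : bisector_foot A B C D.
  apply/bisector_footP => //.
  by rewrite /D [A + _ - A]addrC addKr scalerA divff ?gt_eqF// scale1r.
by exists D => //; apply: (mulIf (lt0r_neq0 s0)); rewrite h lenE.
Qed.

(** Orthogonality forces [t * AB^2 = dot (B - A) (C - A)] for the parameter [t] of the foot, which
    gives the squared height; [0 <= h] allows the square root to be taken. *)
Lemma height_lengthP A B C h : nondegenerate_triangle A B C -> 0 <= h ->
  height_length C A B h <->
  (h * edist A B) ^+ 2 =
    (edist A B * edist A C) ^+ 2 - dot (B - A) (C - A) ^+ 2.
Proof.
move=> ABC h0; have /nondegenerateE/cross_neq0[B0 C0] := ABC.
have c0 : 0 < edist A B by rewrite enorm_gt0.
have lenE H : altitude_foot C A B H -> (edist C H * edist A B) ^+ 2 =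
    (edist A B * edist A C) ^+ 2 - dot (B - A) (C - A) ^+ 2.
  move=> [[t HE] ort]; rewrite !exprMn.
  have tE : t * edist A B ^+ 2 = dot (B - A) (C - A).
    by move: ort; rewrite enorm_sqr HE !dotE !mxE => ort; lra.
  have -> : edist C H ^+ 2 = edist A C ^+ 2
      - 2 * t * dot (B - A) (C - A) + t ^+ 2 * edist A B ^+ 2.
    by rewrite /edist !enorm_sqr HE !dotE !mxE; ring.
  by rewrite -tE; ring.
split=> [[H /lenE + <-]//|e].
pose t := dot (B - A) (C - A) / edist A B ^+ 2.
have tE : t * dot (B - A) (B - A) = dot (B - A) (C - A).
  by rewrite -enorm_sqr divfK// gt_eqF// exprn_gt0.
have HP : altitude_foot C A B ((1 - t) *: A + t *: B).
  by split; [exists t|move: tE; rewrite !dotE !mxE => tE; lra].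
exists ((1 - t) *: A + t *: B) => //.
have /eqP := lenE _ HP; rewrite -e eqrXn2 ?mulr_ge0 ?enorm_ge0// => /eqP.
exact/mulIf/lt0r_neq0.
Qed.

(* The isometry is [P |-> (P - A) M + A'] with [M = W^-1 W'], where [W] and [W']
   have rows [B - A], [C - A] and [B' - A'], [C' - A']; [M] is orthogonal because
   [W] and [W'] have the same Gram matrix. *)
Lemma congruent_gram A B C A' B' C' : nondegenerate_triangle A B C ->
  edist A B = edist A' B' -> edist A C = edist A' C' ->
  dot (B - A) (C - A) = dot (B' - A') (C' - A') ->
  congruent A B C A' B' C'.
Proof.
rewrite /nondegenerate_triangle.
set u := B - A; set v := C - A; set u' := B' - A'; set v' := C' - A'.
move=> ABC eB eC eG.
pose W : 'M_2 := col_mx u v; pose W' : 'M_2 := col_mx u' v'.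
have Wu : W \in unitmx by rewrite -row_free_unit.
have gram (a b : 'rV[R]_2) : col_mx a b *m (col_mx a b)^T =
    block_mx (a *m a^T) (a *m b^T) (b *m a^T) (b *m b^T).
  by rewrite tr_col_mx mul_col_row.
have dot_mx (a b : 'rV[R]_2) : a *m b^T = (dot a b)%:M by rewrite -mx11_scalar.
have dotC (a b : 'rV[R]_2) : dot a b = dot b a by rewrite !dotE; ring.
have WW : W *m W^T = W' *m W'^T.
  apply: etrans (gram u v) (etrans _ (esym (gram u' v')));
    rewrite !dot_mx eG [dot v u]dotC [dot v' u']dotC eG.
  by rewrite -!enorm_sqr -[enorm u]/(edist A B) -[enorm v]/(edist A C) eB eC.
pose M := invmx W *m W'.
have MM : M *m M^T = 1%:M.
  rewrite trmx_mul mulmxA -(mulmxA _ W') -WW !mulmxA mulVmx// mul1mx.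
  by rewrite trmx_inv mulmxV// unitmx_tr.
have WM : W *m M = W' by rewrite mulmxA mulmxV// mul1mx.
have [uM vM] : u *m M = u' /\ v *m M = v'.
  exact/eq_col_mx/(etrans (esym (mul_col_mx u v M)) WM).
exists (fun P => (P - A) *m M + A').
  move=> P Q /=; rewrite /edist /enorm; congr Num.sqrt.
  rewrite opprD addrACA subrr addr0 -mulmxBl opprB addrA subrK.
  rewrite /dot trmx_mul mulmxA.
  by rewrite -(mulmxA _ M) MM mulmx1.
by rewrite subrr mul0mx add0r -/u -/v uM vM /u' /v' !subrK.
Qed.
End PlaneVectors.

(** * Half-angles *)

Section HalfAngles.
Variable R : realType.
Implicit Types (x l c k s m : R).

(** The cosine and sine of half an angle in (0, pi), kept as a point of an open unit arc so that the
    arguments stay algebraic. *)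
Definition half_angle k s := [/\ 0 < k, 0 < s & k ^+ 2 + s ^+ 2 = 1].

(** The cotangent of the whole angle, by the double-angle formulas. *)
Definition cot2 k s := (k ^+ 2 - s ^+ 2) / (2 * s * k).

(** The bisector formula l (b + c) = 2 b c k multiplied by 2 s k, with b eliminated through the
    altitude x = 2 b s k. *)
Definition bisector_eq x l c k s := l * (x + 2 * c * k * s) = 2 * c * k * x.

Lemma half_angle_exists m : -1 < m < 1 ->
  exists k s, half_angle k s /\ k ^+ 2 - s ^+ 2 = m.
Proof.
move=> /andP[m1 m2]; exists (Num.sqrt ((1 + m) / 2)), (Num.sqrt ((1 - m) / 2)).
have k0 : 0 < (1 + m) / 2 by lra.
have s0 : 0 < (1 - m) / 2 by lra.
by rewrite /half_angle !sqrtr_gt0 k0 s0 !sqr_sqrtr ?ltW//; split; [split=> //|]; lra.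
Qed.

Lemma half_angle_le k s k' s' : half_angle k s -> half_angle k' s' ->
  k <= k' -> s' <= s.
Proof.
move=> [/ltW k0 /ltW s0 e] [/ltW k0' /ltW s0' e'].
by rewrite -ler_sqr// -[s' <= s]ler_sqr// => ?; lra.
Qed.

Lemma half_angle_inj k s k' s' : half_angle k s -> half_angle k' s' ->
  k = k' -> s = s'.
Proof.
move=> h h' e; apply/eqP; rewrite eq_le (half_angle_le h' h) ?e//.
by rewrite (half_angle_le h h') ?e.
Qed.

Lemma cot2E k s : half_angle k s -> cot2 k s = (k / s - s / k) / 2.
Proof.
move=> [k0 s0 _]; rewrite /cot2; field.
by rewrite ?gt_eqF ?lt0r_neq0 // ?k0 ?s0.
Qed.

(** In the form (k / s - s / k) / 2 both terms are monotone, since [s] decreases as [k] increases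
    along the arc. *)
Lemma cot2_le k s k' s' : half_angle k s -> half_angle k' s' ->
  k <= k' -> cot2 k s <= cot2 k' s'.
Proof.
move=> h h' le_k; have le_s := half_angle_le h h' le_k.
rewrite !cot2E// ler_pM2r ?invr_gt0//; case: h h' => [k0 s0 _] [k0' s0' _].
by apply: lerB; apply: ler_pM; rewrite ?lef_pV2 ?posrE ?invr_ge0 //; exact: ltW.
Qed.

(* [bisector_eq] reads [x / l = x / (2 c k) + s], whose right-hand side is
   decreasing in [c] and, along the unit circle, decreasing in [k]. *)
Lemma bisector_eq_le x l c c' k s k' s' : 0 < x -> 0 < l -> 0 < c -> c <= c' ->
  half_angle k s -> half_angle k' s' ->
  bisector_eq x l c k s -> bisector_eq x l c' k' s' -> k' <= k.
Proof.
move=> x0 l0 c0 cc' h h' e e'; rewrite leNgt; apply/negP => kk'.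
have ss' := half_angle_le h h' (ltW kk').
case: h h' => [k0 s0 _] [k0' s0' _].
(* Both equations write [l * x] as a product of positive factors. With [k < k'] the primed product
   has a strictly larger first factor and a second factor at least as large, whence
   [l * x < l * x]. *)
have lx : l * x = (2 * c * k) * (x - l * s).
  by move: e; rewrite /bisector_eq => e; lra.
have lx' : l * x = (2 * c' * k') * (x - l * s').
  by move: e'; rewrite /bisector_eq => e'; lra.
have c0' := lt_le_trans c0 cc'.
have p0 : 0 < x - l * s.
  have : 0 < (2 * c * k) * (x - l * s) by rewrite -lx mulr_gt0.
  by rewrite pmulr_rgt0// !mulr_gt0.
have le2 : x - l * s <= x - l * s' by rewrite lerD2l lerN2 ler_pM2l.
have lt1 : 2 * c * k < 2 * c' * k'.
  apply: (@le_lt_trans _ _ (2 * c' * k)).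
    by rewrite ler_pM2r// ler_pM2l.
  by rewrite ltr_pM2l// mulr_gt0.
have : l * x < l * x.
  rewrite {1}lx lx'; apply: (@lt_le_trans _ _ (2 * c' * k' * (x - l * s))).
    by rewrite ltr_pM2r.
  by rewrite ler_pM2l// !mulr_gt0.
by rewrite ltxx.
Qed.

Lemma half_angle_unique x l l' c1 k1 s1 k1' s1' c2 k2 s2 k2' s2' :
  0 < x -> 0 < l -> 0 < l' -> 0 < c1 -> 0 < c2 ->
  half_angle k1 s1 -> half_angle k1' s1' ->
  half_angle k2 s2 -> half_angle k2' s2' ->
  c1 = x * (cot2 k1 s1 + cot2 k1' s1') ->
  c2 = x * (cot2 k2 s2 + cot2 k2' s2') ->
  bisector_eq x l c1 k1 s1 -> bisector_eq x l' c1 k1' s1' ->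
  bisector_eq x l c2 k2 s2 -> bisector_eq x l' c2 k2' s2' ->
  [/\ c1 = c2, k1 = k2 & s1 = s2].
Proof.
move=> x0 l0 l0' p1 p2 h1 h1' h2 h2' E1 E2 e1 e1' e2 e2'.
have cc : c1 = c2.
  have /orP[le|le] := le_total c1 c2; apply/eqP; rewrite eq_le le ?andbT /=.
    rewrite E1 E2 ler_pM2l//; apply: lerD.
      exact: cot2_le h2 h1 (bisector_eq_le x0 l0 p1 le h1 h2 e1 e2).
    exact: cot2_le h2' h1' (bisector_eq_le x0 l0' p1 le h1' h2' e1' e2').
  rewrite E1 E2 ler_pM2l//; apply: lerD.
    exact: cot2_le h1 h2 (bisector_eq_le x0 l0 p2 le h2 h1 e2 e1).
  exact: cot2_le h1' h2' (bisector_eq_le x0 l0' p2 le h2' h1' e2' e1').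
have kk : k1 = k2.
  apply/eqP; rewrite eq_le (bisector_eq_le x0 l0 p2 _ h2 h1 e2 e1) ?cc//.
  by rewrite (bisector_eq_le x0 l0 p1 _ h1 h2 e1 e2) ?cc.
by split=> //; exact: half_angle_inj h1 h2 kk.
Qed.

End HalfAngles.

(** * Existence of half-angles *)

Section Existence.
Variable R : realType.
Variables (w w1 : R).
(* With [w = x / l2] and [w1 = x / l1], the bisector from [A] gives
   [x / c = 2 k (w - s)] for [k = cosA s].  The vector [(dirU s, dirV s)] is
   [(s / c) (c - x cot A, x)]; its polar angle is [B] because
   [c - x cot A = x cot B], and unlike [c] and [cot A] it has finite nonzero
   values at both ends of the range of [s]. *)
Definition cosA (s : R) : R := Num.sqrt (1 - s ^+ 2).
Definition dirU (s : R) : R := s - (w - s) * (1 - 2 * s ^+ 2).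
Definition dirV (s : R) : R := 2 * cosA s * s * (w - s).
Definition cosB (s : R) : R := dirU s / Num.sqrt (dirU s ^+ 2 + dirV s ^+ 2).
(** The bisector from B reads w1 = x / (2 c k') + s' with k' = cos (B / 2) and s' = sin (B / 2).
    Substituting x / c = 2 k (w - s) and multiplying by k' turns it into [defect s = 0]. *)
Definition defect (s : R) : R :=
  cosA s * (w - s) +
  Num.sqrt ((1 + cosB s) / 2) * (Num.sqrt ((1 - cosB s) / 2) - w1).

Lemma continuous_sqrt_comp (f : R -> R) (a : R) :
  {for a, continuous f} -> {for a, continuous (fun s => Num.sqrt (f s))}.
Proof. by move=> cf; apply: (continuous_comp cf); exact: sqrt_continuous. Qed.

(** [Num.sqrt] is continuous on the whole line, so the denominator of [cosB] is the only place where
    continuity could fail. *)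
Lemma continuous_defect (s : R) : 0 < dirU s ^+ 2 + dirV s ^+ 2 ->
  {for s, continuous defect}.
Proof.
move=> n0.
have cid : {for s, continuous (fun s : R => s)} by exact: cvg_id.
have ccst (r : R) : {for s, continuous (fun _ : R => r)} by exact: cvg_cst.
have cD (f g : R -> R) : {for s, continuous f} -> {for s, continuous g} ->
  {for s, continuous (fun s => f s + g s)} by exact: continuousD.
have cM (f g : R -> R) : {for s, continuous f} -> {for s, continuous g} ->
  {for s, continuous (fun s => f s * g s)} by exact: continuousM.
have cB (f g : R -> R) : {for s, continuous f} -> {for s, continuous g} ->
  {for s, continuous (fun s => f s - g s)} by exact: continuousB.
have cA : {for s, continuous cosA}.
  by apply: continuous_sqrt_comp; apply: (cB) => //; exact: (cM).
have cU : {for s, continuous dirU}.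
  apply: (cB) => //; apply: (cM); first exact: cB.
  by apply: (cB) => //; apply: (cM) => //; exact: (cM).
have cV : {for s, continuous dirV}.
  by apply: (cM); [apply: (cM) => //; exact: (cM)|exact: cB].
have cosBc : {for s, continuous cosB}.
  apply: (cM) => //; apply: continuousV; first by rewrite gt_eqF// sqrtr_gt0.
  by apply: continuous_sqrt_comp; apply: (cD); exact: (cM).
apply: (cD); first by apply: (cM) => //; exact: (cB).
apply: (cM); last apply: (cB) => //; apply: continuous_sqrt_comp; apply: (cM) => //.
  exact: (cD).
exact: (cB).
Qed.

Hypothesis (w0 : 0 < w) (w10 : 0 < w1).

Lemma cosA_gt0 s : 0 < s < 1 -> 0 < cosA s.
Proof. by move=> /andP[s0 s1]; rewrite sqrtr_gt0; nra. Qed.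

Lemma dir_boundary s : s = 1 \/ s = w -> dirU s = w /\ dirV s = 0.
Proof.
rewrite /dirU /dirV /cosA => -[] ->; last by split; ring.
by rewrite expr1n subrr sqrtr0; split; ring.
Qed.

(** At either right end the direction is (w, 0), so B = 0, and the first summand vanishes because
    [cosA s] or [w - s] does. *)
Lemma defect_boundary s : s = 1 \/ s = w -> defect s = - w1.
Proof.
move=> sE; have [U V] := dir_boundary sE.
have B : cosB s = 1.
  by rewrite /cosB U V expr0n addr0 sqrtr_sqr gtr0_norm// divff// gt_eqF.
rewrite /defect B subrr mul0r sqrtr0 (_ : (1 + 1) / 2 = 1); last by lra.
rewrite sqrtr1; case: sE => ->; last by ring.
by rewrite /cosA expr1n subrr sqrtr0; ring.
Qed.

(** At [s = 0] the direction is (-w, 0), so B = pi and cos (B / 2) = 0: only the first summand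
    survives. *)
Lemma defect0 : defect 0 = w.
Proof.
have B : cosB 0 = - 1.
  have -> : cosB 0 = - w / Num.sqrt ((- w) ^+ 2).
    by rewrite /cosB /dirU /dirV; congr (_ / Num.sqrt _); ring.
  by rewrite sqrtr_sqr normrN gtr0_norm// mulNr divff// gt_eqF.
rewrite /defect B subrr mul0r sqrtr0 /cosA expr0n /= subr0 sqrtr1; ring.
Qed.

(** Inside the range [dirV] is positive; at the ends it vanishes, but there [dirU] is [w] or
    [- w]. *)
Lemma dir_norm_gt0 s : 0 <= s -> s <= 1 -> s <= w ->
  0 < dirU s ^+ 2 + dirV s ^+ 2.
Proof.
move=> s0 s1 sw.
have dirU_norm : dirU s = w \/ dirU s = - w -> 0 < dirU s ^+ 2 + dirV s ^+ 2.
  move=> h; apply: ltr_pwDl; last exact: sqr_ge0.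
  by case: h => ->; rewrite ?sqrrN exprn_gt0.
move: s0; rewrite le_eqVlt => /orP[/eqP e|s0].
  by apply: dirU_norm; right; rewrite /dirU -e; ring.
move: s1; rewrite le_eqVlt => /orP[/eqP e|s1].
  by apply: dirU_norm; left; case: (dir_boundary (or_introl e)).
move: sw; rewrite le_eqVlt => /orP[/eqP e|sw].
  by apply: dirU_norm; left; case: (dir_boundary (or_intror e)).
apply: ltr_wpDl; first exact: sqr_ge0.
by rewrite exprn_gt0// !mulr_gt0 ?subr_gt0// cosA_gt0// s0.
Qed.

Lemma defect_root : exists s, [/\ 0 < s, s < 1, s < w & defect s = 0].
Proof.
(* The bound [s < 1] keeps cos (A / 2) positive and [s < w] keeps [c] positive. The values [w] and
   [- w1] at the ends have opposite signs and are nonzero, so the root is interior. *)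
pose sm := Num.min 1 w.
have smE : sm = 1 \/ sm = w by rewrite /sm; case: leP => _; [left|right].
have sm0 : 0 <= sm by rewrite le_min ler01 ltW.
have [||s] := @IVT R defect 0 sm 0 sm0.
- apply: continuous_in_subspaceT => s; rewrite inE/= in_itv/= => /andP[s0].
  by rewrite le_min => /andP[s1 sw]; exact/continuous_defect/dir_norm_gt0.
- by rewrite defect0 (defect_boundary smE) ge_min le_max (ltW w0)
    oppr_le0 (ltW w10) orbT.
rewrite in_itv/= le_min => /and3P[s0 s1 sw] ds; exists s; split=> //.
- rewrite lt0r s0 andbT; apply/eqP => e.
  by move: ds w0; rewrite e defect0 => ->; rewrite ltxx.
- rewrite lt_neqAle s1 andbT; apply/eqP => e.
  by have := defect_boundary (or_introl e); rewrite ds => h; move: w10; lra.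
- rewrite lt_neqAle sw andbT; apply/eqP => e.
  by have := defect_boundary (or_intror e); rewrite ds => h; move: w10; lra.
Qed.
End Existence.

Lemma half_angle_solution (R : realType) (x l l' : R) :
  0 < x -> 0 < l -> 0 < l' ->
  exists c k s k' s', [/\ half_angle k s, half_angle k' s', 0 < c,
     c = x * (cot2 k s + cot2 k' s')
   & bisector_eq x l c k s /\ bisector_eq x l' c k' s'].
Proof.
move=> x0 l0 l0'.
have w0 : 0 < x / l by rewrite divr_gt0.
have w0' : 0 < x / l' by rewrite divr_gt0.
have [s [s0 s1 sw]] := defect_root w0 w0'.
have k0 : 0 < cosA s by rewrite cosA_gt0// s0.
have ks : cosA s ^+ 2 = 1 - s ^+ 2 by rewrite sqr_sqrtr//; nra.
have V0 : 0 < dirV (x / l) s by rewrite !mulr_gt0 ?subr_gt0.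
have N0 := dir_norm_gt0 w0 (ltW s0) (ltW s1) (ltW sw).
set U := dirU (x / l) s in N0; set V := dirV (x / l) s in V0 N0.
set N := Num.sqrt (U ^+ 2 + V ^+ 2).
have Npos : 0 < N by rewrite sqrtr_gt0.
have NE : N ^+ 2 = U ^+ 2 + V ^+ 2 by rewrite sqr_sqrtr// ltW.
(* Strict because [V] is positive, so that [N] exceeds the absolute value of [U]. *)
have m1 : -1 < U / N < 1.
  by rewrite ltr_pdivlMr// ltr_pdivrMr//; apply/andP; split; nra.
rewrite /defect /cosB -/U -/V -/N.
set k' := Num.sqrt ((1 + U / N) / 2); set s' := Num.sqrt ((1 - U / N) / 2) => e.
have [k0' s0' ks' kU] : [/\ 0 < k', 0 < s', k' ^+ 2 + s' ^+ 2 = 1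
    & k' ^+ 2 - s' ^+ 2 = U / N].
  case/andP: m1 => m1 m2.
  have a0 : 0 < (1 + U / N) / 2 by lra.
  have b0 : 0 < (1 - U / N) / 2 by lra.
  by rewrite !sqrtr_gt0 a0 b0 !sqr_sqrtr ?ltW//; split=> //; lra.
(* This is sin B; both sides are nonnegative, so comparing squares suffices. *)
have kV : 2 * s' * k' = V / N.
  have L0 : 0 <= 2 * s' * k' by rewrite ltW ?mulr_gt0.
  have R0 : 0 <= V / N by rewrite ltW ?divr_gt0.
  apply/eqP; rewrite -(eqrXn2 (n := 2))//.
  have -> : (2 * s' * k') ^+ 2 =
    (k' ^+ 2 + s' ^+ 2) ^+ 2 - (k' ^+ 2 - s' ^+ 2) ^+ 2 by ring.
  rewrite ks' kU !expr_div_n NE; apply/eqP; field.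
  by rewrite gt_eqF// -NE exprn_gt0.
have ws : 0 < x / l - s by rewrite subr_gt0.
(* The bisector equation from A, solved for [c]. *)
pose c := x / (2 * cosA s * (x / l - s)).
have c0 : 0 < c by rewrite divr_gt0// !mulr_gt0.
exists c, (cosA s), s, k', s'; split=> //.
- by split=> //; rewrite ks subrK.
- have -> : cot2 k' s' = U / V.
    by rewrite /cot2 kU kV; field; rewrite !gt_eqF.
  rewrite /cot2 ks /c /U /V /dirU /dirV; move: ws; set w := x / l => ws.
  by field; rewrite !gt_eqF.
have ls : 0 < x - l * s.
  by rewrite (_ : _ - _ = l * (x / l - s)) ?mulr_gt0//; field; rewrite gt_eqF.
have c_eq : 2 * c * cosA s = x / (x / l - s).
  by rewrite /c; field; rewrite !gt_eqF//; lra.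
have w'E : l' * (x / l') = x by field; rewrite gt_eqF.
rewrite /bisector_eq; split.
  by rewrite c_eq; field; rewrite !gt_eqF//; lra.
have xE : x = 2 * c * cosA s * (x / l - s) by rewrite c_eq divfK ?gt_eqF.
rewrite (_ : x + _ = 2 * c * k' * (x / l')).
  by rewrite mulrCA w'E.
(* With the first [x] expanded through [c], the equation is [2 * c] times the vanishing of the
   defect. *)
rewrite {1}xE; apply: (eq_lincomb (k := 2 * c) e); ring.
Qed.

(** * Triangles from half-angles *)

Section Triangles.
Variable R : realType.
Implicit Types (A B C : 'rV[R]_2) (x l c k s : R).

Lemma edist_gt0 A B C : nondegenerate_triangle A B C ->
  [/\ 0 < edist A B, 0 < edist A C & 0 < edist B C].
Proof.
move=> ABC; have /nondegenerateE/cross_neq0[B0 C0] := ABC.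
have /nondegenerateE/cross_neq0[_ BC0] := nondegenerate_swap ABC.
by rewrite !enorm_gt0.
Qed.

Lemma half_angle_dot A B C : nondegenerate_triangle A B C ->
  exists k s, half_angle k s /\
    dot (B - A) (C - A) = edist A B * edist A C * (k ^+ 2 - s ^+ 2).
Proof.
move=> ABC; have [c0 b0 _] := edist_gt0 ABC.
have /nondegenerateE/dot_lt := ABC; rewrite -!/(edist _ _) => /andP[g1 g2].
have cb := mulr_gt0 c0 b0.
have m1 : -1 < dot (B - A) (C - A) / (edist A B * edist A C) < 1.
  by rewrite ltr_pdivlMr// ltr_pdivrMr// mulN1r mul1r g1 g2.
have [k [s [ks e]]] := half_angle_exists m1.
by exists k, s; split=> //; rewrite e mulrC divfK// gt_eqF.
Qed.

Lemma height_half_angle A B C k s x : nondegenerate_triangle A B C -> 0 <= x ->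
  half_angle k s ->
  dot (B - A) (C - A) = edist A B * edist A C * (k ^+ 2 - s ^+ 2) ->
  height_length C A B x <-> x = edist A C * (2 * s * k).
Proof.
move=> ABC x0 [k0 s0 ks] g; have [c0 b0 _] := edist_gt0 ABC.
rewrite height_lengthP// g.
have -> : (edist A B * edist A C) ^+ 2 -
    (edist A B * edist A C * (k ^+ 2 - s ^+ 2)) ^+ 2 =
    (edist A C * (2 * s * k) * edist A B) ^+ 2.
  (* The difference of the sides is (AB AC)^2 (1 - (k^2 + s^2)^2), which is divisible by k^2 + s^2 -
     1. *)
  apply: (eq_lincomb (k := - (edist A B * edist A C) ^+ 2 *
    (k ^+ 2 + s ^+ 2 + 1)) ks); ring.
have h0 : 0 <= edist A C * (2 * s * k) by rewrite !mulr_ge0// ltW.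
have xc0 := mulr_ge0 x0 (ltW c0); have hc0 := mulr_ge0 h0 (ltW c0).
split=> [/eqP|-> //]; rewrite eqrXn2// => /eqP; exact/mulIf/lt0r_neq0.
Qed.

Lemma bisector_half_angle A B C k s x l : nondegenerate_triangle A B C ->
  half_angle k s ->
  dot (B - A) (C - A) = edist A B * edist A C * (k ^+ 2 - s ^+ 2) ->
  x = edist A C * (2 * s * k) ->
  bisector_length A B C l <-> bisector_eq x l (edist A B) k s.
Proof.
move=> ABC [k0 s0 ks] g xE.
rewrite (bisector_lengthP _ ABC (ltW k0)); last by rewrite g; congr (_ * _); lra.
have sk0 : 2 * s * k != 0 by rewrite gt_eqF// !mulr_gt0.
rewrite /bisector_eq xE; split=> h; last apply: (mulIf sk0).
  apply: (eq_lincomb (k := 2 * s * k) h); ring.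
apply: (eq_lincomb (k := 1) h); ring.
Qed.

Lemma dot_swap A B C :
  dot (A - B) (C - B) = edist A B ^+ 2 - dot (B - A) (C - A).
Proof. by rewrite /edist enorm_sqr !dotE !mxE; ring. Qed.

Lemma height_length_sym A B C h :
  height_length C A B h -> height_length C B A h.
Proof.
move=> [H [[t ->] o] <-]; exists ((1 - t) *: A + t *: B) => //; split.
  by exists (1 - t); rewrite subKr addrC.
by move: o; rewrite !dotE !mxE => o; lra.
Qed.

Lemma angleC (P Q S : 'rV[R]_2) : angle P Q S = angle S Q P.
Proof.
by rewrite /angle [enorm _ * _]mulrC; congr (acos (_ / _)); rewrite !dotE; ring.
Qed.

(** Bridges the order [B C A] of the theorem and the order [B A C], in which AB is the first side at
    both vertices. *)
Lemma bisector_length_sym A B C l :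
  bisector_length A B C l -> bisector_length A C B l.
Proof.
move=> [D [[t /andP[t0 t1] DE] a] DA]; exists D => //; split; last first.
  by rewrite angleC -a angleC.
exists (1 - t); first by rewrite subr_ge0 t1 gerBl.
by rewrite subKr addrC.
Qed.

Lemma height_half_angles A B C x : nondegenerate_triangle A B C -> 0 < x ->
  height_length C A B x ->
  exists k s k' s', [/\ half_angle k s, half_angle k' s',
    dot (B - A) (C - A) = edist A B * edist A C * (k ^+ 2 - s ^+ 2) /\
    dot (A - B) (C - B) = edist A B * edist B C * (k' ^+ 2 - s' ^+ 2),
    x = edist A C * (2 * s * k) /\ x = edist B C * (2 * s' * k')
  & edist A B = x * (cot2 k s + cot2 k' s')].
Proof.
move=> ABC x0 hx; have [c0 b0 a0] := edist_gt0 ABC.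
have [k [s [ks g]]] := half_angle_dot ABC.
have BAC := nondegenerate_swap ABC.
have [k' [s' [ks' g']]] := half_angle_dot BAC.
have xE := (height_half_angle ABC (ltW x0) ks g).1 hx.
have xE' := (height_half_angle BAC (ltW x0) ks' g').1 (height_length_sym hx).
rewrite [edist B A]edistC in g'.
(* The two copies of [x] are replaced by b sin A and a sin B respectively, where a = BC and b = AC.
   The claim becomes the projection formula c = b cos A + a cos B, which is [gg] divided by c =
   AB. *)
exists k, s, k', s'; split=> //; rewrite mulrDr {1}xE xE' /cot2.
have gg := dot_swap A B C; rewrite g' g in gg.
case: ks ks' => [k0 s0 _] [k0' s0' _].
have cE : edist A B =
    edist A C * (k ^+ 2 - s ^+ 2) + edist B C * (k' ^+ 2 - s' ^+ 2).
  apply: (mulfI (lt0r_neq0 c0)); lra.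
by rewrite {1}cE; field; rewrite !gt_eqF.
Qed.

Lemma half_angles_triangle x c k s k' s' : 0 < x -> 0 < c ->
  half_angle k s -> half_angle k' s' -> c = x * (cot2 k s + cot2 k' s') ->
  exists A B C, [/\ nondegenerate_triangle A B C, height_length C A B x,
    edist A B = c,
    dot (B - A) (C - A) = edist A B * edist A C * (k ^+ 2 - s ^+ 2) /\
    dot (A - B) (C - B) = edist A B * edist B C * (k' ^+ 2 - s' ^+ 2)
  & x = edist A C * (2 * s * k) /\ x = edist B C * (2 * s' * k')].
Proof.
move=> x0 c0 ks ks' cE.
pose pt (a b : R) : 'rV[R]_2 := \row_j (if j == 0 then a else b).
have pt0 a b : pt a b 0 0 = a by rewrite mxE.
have pt1 a b : pt a b 0 1 = b by rewrite mxE.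
have subE (P Q : 'rV[R]_2) i : (Q - P) 0 i = Q 0 i - P 0 i by rewrite !mxE.
(* AB lies on the first axis; C has height [x] and its altitude foot is at distance x cot A from A,
   signed towards B. By [cE] the remaining part of AB is x cot B. *)
pose A := pt 0 0; pose B := pt c 0; pose C := pt (x * cot2 k s) x.
have dE (P Q : 'rV[R]_2) r : 0 < r ->
    (Q 0 0 - P 0 0) ^+ 2 + (Q 0 1 - P 0 1) ^+ 2 = r ^+ 2 -> edist P Q = r.
  move=> r0; rewrite /edist /enorm dotE !mxE -!expr2 => ->.
  by rewrite sqrtr_sqr gtr0_norm.
have cotE k1 s1 : half_angle k1 s1 ->
    (x * cot2 k1 s1) ^+ 2 + x ^+ 2 = (x / (2 * s1 * k1)) ^+ 2.
  move=> [k10 s10 e].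
  apply: (eq_lincomb (k := (x / (2 * s1 * k1)) ^+ 2 * (k1 ^+ 2 + s1 ^+ 2 + 1)) e).
  by rewrite /cot2; field; rewrite !gt_eqF.
have r0 k1 s1 : half_angle k1 s1 -> 0 < x / (2 * s1 * k1).
  by move=> [k10 s10 _]; rewrite divr_gt0// !mulr_gt0.
have AB : edist A B = c by apply: dE => //; rewrite !pt0 !pt1; ring.
have AC : edist A C = x / (2 * s * k).
  by apply: dE; [exact: r0|rewrite -cotE// !pt0 !pt1 !subr0].
have BC : edist B C = x / (2 * s' * k').
  by apply: dE; [exact: r0|rewrite -cotE// !pt0 !pt1 cE; ring].
have ABC : nondegenerate_triangle A B C.
  apply/nondegenerateE; rewrite /cross !subE !pt0 !pt1.
  by rewrite !subr0 mul0r subr0 gt_eqF// mulr_gt0.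
have g : dot (B - A) (C - A) = c * (x * cot2 k s).
  by rewrite dotE !subE !pt0 !pt1; ring.
have g' : dot (A - B) (C - B) = c * (x * cot2 k' s').
  by rewrite dot_swap AB g; apply: (eq_lincomb (k := c) cE); ring.
have angleE k1 s1 : half_angle k1 s1 ->
    x * cot2 k1 s1 = x / (2 * s1 * k1) * (k1 ^+ 2 - s1 ^+ 2).
  by move=> _; rewrite /cot2; ring.
have xE k1 s1 : half_angle k1 s1 -> x = x / (2 * s1 * k1) * (2 * s1 * k1).
  by move=> [k10 s10 _]; rewrite divfK// gt_eqF// !mulr_gt0.
have gE : dot (B - A) (C - A) = edist A B * edist A C * (k ^+ 2 - s ^+ 2).
  by rewrite g AB AC -mulrA -angleE.
exists A, B, C; split=> //.
- by apply/(height_half_angle ABC (ltW x0) ks gE); rewrite AC -xE.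
- by split=> //; rewrite g' AB BC -mulrA -angleE.
- by rewrite AC BC -!xE.
Qed.

End Triangles.

Theorem mainTheorem9 (R : realType) (l1 l2 : R) (hl2 : 0 < l2) (hl : l2 <= l1)
    (x : R) (hx : 0 < x) :
  exists A B C : 'rV[R]_2,
    [/\ nondegenerate_triangle A B C,
        bisector_length A B C l2,
        bisector_length B C A l1
      & height_length C A B x]
    /\ forall A' B' C' : 'rV[R]_2,
         [/\ nondegenerate_triangle A' B' C',
             bisector_length A' B' C' l2,
             bisector_length B' C' A' l1
           & height_length C' A' B' x] ->
         congruent A B C A' B' C'.
Proof.
have hl1 := lt_le_trans hl2 hl.
have [c [k [s [k' [s' [ks ks' c0 cE [e e']]]]]]] := half_angle_solution hx hl2 hl1.
have [A [B [C [ABC hC AB [g g'] [xE xE']]]]] :=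
  half_angles_triangle hx c0 ks ks' cE.
exists A, B, C; split.
  split=> //; first by apply/(bisector_half_angle _ ABC ks g xE); rewrite AB.
  have BAC := nondegenerate_swap ABC.
  apply/bisector_length_sym/(bisector_half_angle _ BAC ks' _ xE').
    by rewrite [edist B A]edistC.
  by rewrite [edist B A]edistC AB.
move=> A' B' C' [ABC' bA bB hC'].
have [k2 [s2 [k2' [s2' [ks2 ks2' [g2 g2'] [xE2 xE2'] cE2]]]]] :=
  height_half_angles ABC' hx hC'.
have [c20 _ _] := edist_gt0 ABC'.
have e2 := (bisector_half_angle _ ABC' ks2 g2 xE2).1 bA.
rewrite [edist A' B']edistC in g2'.
have e2' := (bisector_half_angle _ (nondegenerate_swap ABC') ks2' g2' xE2').1
  (bisector_length_sym bB).
rewrite [edist B' A']edistC in e2'.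
have [ccE kkE ssE] := half_angle_unique hx hl2 hl1 c0 c20 ks ks' ks2 ks2'
  cE cE2 e e' e2 e2'.
(* Equal altitudes [x = AC * (2 * s * k)] and equal half-angles at A force equal sides; with AB and
   the dot product this completes the Gram data. *)
have bE : edist A C = edist A' C'.
  have [k20 s20 _] := ks2.
  have sk0 : 2 * s2 * k2 != 0 by rewrite gt_eqF// !mulr_gt0.
  by apply: (mulIf sk0); rewrite -xE2 -kkE -ssE -xE.
apply: congruent_gram => //; first by rewrite AB.
by rewrite g g2 AB ccE bE kkE ssE.
Qed.
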